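(* On $(M_1\times M_2,h_{f_1f_2})$, let $\{e_1,\dots,e_{m_1}\}$ be a local orthonormal frame field of $M_1$ with respect to $g_1$ and $\{e_{m_1+1},\dots,e_{m_1+m_2}\}$ a local orthonormal frame field of $M_2$ with respect to $g_2$. Put $$u'_i=-\frac{(cf_2^v)^2a_i^h}{1+(cf_2^v)^2B_i^h}T_i^h+e_i^h,\quad i\in\{1,\dots,m_1\};\qquad u'_i=\frac{1}{f_1^h}e_i^v,\quad i\in\{m_1+1,\dots,m_1+m_2\},$$ where for $i\in\{1,\dots,m_1\}$, $a_i=e_i(f_1)$, $B_i=\sum_{j=1}^{i-1}a_j^2$ (also for $i=m_1+1$), $T_i=\sum_{j=1}^{i-1}a_je_j$. Let $u_i=\frac1{\|u'_i\|}u'_i$ for $i\in\{1,\dots,m_1\}$ and $u_i=u'_i$ for $i>m_1$. Then, for $i\in\{1,\dots,m_1\}$, $$\|u'_i\|^2=\frac{1+(cf_2^v)^2B_{i+1}^h}{1+(cf_2^v)^2B_i^h},$$ and $\{u_1,\dots,u_{m_1},u_{m_1+1},\dots,u_{m_1+m_2}\}$ is a local orthonormal frame field with respect to the metric $h_{f_1f_2}$.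
   Context: $(M_i,g_i)$, $i=1,2$, are Riemannian manifolds of dimension $m_i$; $\pi_i:M_1\times M_2\to M_i$ are the projections; $\varphi_1^h=\varphi_1\circ\pi_1$, $\varphi_2^v=\varphi_2\circ\pi_2$ for functions. The horizontal lift $X_1^h$ of a vector field $X_1$ on $M_1$ is the vector field on $M_1\times M_2$ with $d\pi_1(X_1^h)=X_1\circ\pi_1$, $d\pi_2(X_1^h)=0$; the vertical lift $X_2^v$ of a vector field on $M_2$ is defined symmetrically. $c\in\mathbb R$ is arbitrary, $f_i:M_i\to(0,\infty)$ is smooth, and $$h_{f_1f_2}=\pi_1^*g_1+(f_1^h)^2\pi_2^*g_2+\frac{c^2}{2}(f_2^v)^2\,df_1^h\odot df_1^h,\qquad \alpha\odot\beta=\alpha\otimes\beta+\beta\otimes\alpha,$$ a Riemannian metric on $M_1\times M_2$. $\|u'_i\|$ is the norm with respect to $h_{f_1f_2}$. Empty sums are zero. *)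

(* Defs.v *)
From HB Require Import structures.
From mathcomp Require Import all_boot all_order all_algebra.
From mathcomp Require Import all_classical all_reals all_analysis.

Set Implicit Arguments.
Unset Strict Implicit.
Unset Printing Implicit Defensive.

Import Order.TTheory GRing.Theory Num.Theory.
Import numFieldNormedType.Exports.

Local Open Scope classical_set_scope.
Local Open Scope ring_scope.

(* Meaningful for U open: C^(k+1) means differentiable with all directional
   derivatives C^k. *)
Fixpoint Ck {R : realType} {V W : normedModType R} (k : nat) (U : set V)
    (f : V -> W) : Prop :=
  match k with
  | 0 => forall x, U x -> {for x, continuous f}
  | k'.+1 => (forall x, U x -> differentiable f x) /\
             (forall v, Ck k' U (fun x => 'D_v f x))
  end.

Definition smooth_on {R : realType} {V W : normedModType R} (U : set V)
    (f : V -> W) : Prop := forall k, Ck k U f.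

Section Ck_lemmas.
Context {R : realType}.
Implicit Types V W Z : normedModType R.

Lemma near_eq_diff V W (f g : V -> W) x : {near x, f =1 g} ->
  differentiable f x ->
  differentiable g x /\ 'd g x = 'd f x :> (V -> W).
Proof.
move=> fg df; have [c e] := (diff_locallyP x f).1 df.
have eg : g \o shift x = cst (g x) + 'd f x +o_ 0 id.
  apply/eqaddoP => _/posnumP[eps].
  have /eqaddoP/(_ _ (gt0 eps)) := e.
  have fgx : f x = g x by exact: nbhs_singleton fg.
  have fg0 : \forall h \near 0, f (h + x) = g (h + x).
    have cx : h + x @[h --> (0 : V)] --> x.
      by rewrite -[X in _ --> X]add0r; apply: cvgD; [exact: cvg_id|exact: cvg_cst].
    exact: (cx [set y | f y = g y] fg).
  by move: fg0; apply: filterS2 => h /= fgh; rewrite !fctE /= -fgh -fgx.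
have eD := diff_unique c eg.
by split=> //; apply/diff_locallyP; rewrite eD.
Qed.

Lemma Ck_eq V W k (U : set V) (f g : V -> W) : open U ->
  (forall x, U x -> f x = g x) -> Ck k U f -> Ck k U g.
Proof.
move=> oU; elim: k f g => [|k IH] f g fg /=.
  move=> h x Ux; rewrite /prop_for /continuous_at -fg//.
  apply: cvg_trans (h x Ux); apply: near_eq_cvg.
  by have := open_nbhs_nbhs (conj oU Ux); apply: filterS => y /fg ->.
have near_fg x : U x -> {near x, f =1 g}.
  by move=> Ux; have := open_nbhs_nbhs (conj oU Ux); apply: filterS => y /fg ->.
case=> h1 h2; split=> [x Ux|v].
  by have [] := near_eq_diff (near_fg x Ux) (h1 x Ux).
apply: IH (h2 v) => x Ux.
by apply: near_eq_derive; exact: near_fg.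
Qed.

Lemma CkD V W k (U : set V) (f g : V -> W) : open U ->
  Ck k U f -> Ck k U g -> Ck k U (fun x => f x + g x).
Proof.
move=> oU; elim: k f g => [|k IH] f g /=.
  by move=> hf hg x Ux; apply: cvgD; [exact: hf|exact: hg].
move=> [f1 f2] [g1 g2]; split=> [x Ux|v].
  by apply: differentiableD; [exact: f1|exact: g1].
apply: Ck_eq oU _ (IH _ _ (f2 v) (g2 v)) => x Ux.
by rewrite -deriveD//; apply: diff_derivable; [exact: f1|exact: g1].
Qed.

Lemma Ck_lin_comp V W Z k (U : set V) (f : V -> W) (L : {linear W -> Z}) :
  open U -> continuous L -> Ck k U f -> Ck k U (L \o f).
Proof.
move=> oU cL; elim: k f => [|k IH] f /=.
  by move=> hf x Ux; apply: continuous_comp; [exact: hf|exact: cL].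
move=> [f1 f2].
have dL y : differentiable L y by exact: linear_differentiable.
have d x : U x -> differentiable (L \o f) x.
  by move=> Ux; apply: differentiable_comp; [exact: f1|exact: dL].
split=> // v; apply: Ck_eq oU _ (IH _ (f2 v)) => x Ux.
have fx := f1 x Ux; have Lfx := dL (f x).
rewrite /= (deriveE _ (d x Ux)) (deriveE _ fx) (diff_comp fx Lfx) /=.
by rewrite (diff_lin _ cL).
Qed.

Lemma Ck_comp_lin V W Z k (U : set W) (f : W -> Z) (L : {linear V -> W}) :
  open U -> continuous L -> Ck k U f -> Ck k (L @^-1` U) (f \o L).
Proof.
move=> oU cL; have oLU : open (L @^-1` U) by exact: open_comp.
elim: k f => [|k IH] f /=.
  by move=> hf x Ux; apply: continuous_comp; [exact: cL|exact: hf].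
move=> [f1 f2].
have dL y : differentiable L y by exact: linear_differentiable.
have d x : U (L x) -> differentiable (f \o L) x.
  by move=> Ux; apply: differentiable_comp; [exact: dL|exact: f1].
split=> // v; apply: Ck_eq oLU _ (IH _ (f2 (L v))) => x Ux.
have fx := f1 _ Ux; have Lx := dL x.
rewrite /= (deriveE _ (d x Ux)) (deriveE _ fx) (diff_comp Lx fx) /=.
by rewrite (diff_lin _ cL).
Qed.

Lemma Ck_subset V W k (U U' : set V) (f : V -> W) :
  U' `<=` U -> Ck k U f -> Ck k U' f.
Proof.
move=> s; elim: k f => [|k IH] f /=; first by move=> h x /s/h.
by case=> h1 h2; split=> [x /s/h1//|v]; exact: IH.
Qed.

Lemma cvg_mx {T : Type} (F : set_system T) {FF : Filter F} (p q : nat)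
    (f : T -> 'M[R]_(p, q)) (l : 'M[R]_(p, q)) :
  (forall i j, f x i j @[x --> F] --> l i j) -> f x @[x --> F] --> l.
Proof.
move=> fl A [P lP PA]; rewrite /nbhs /=.
have : \forall x \near F, forall ij : 'I_p * 'I_q, P ij.1 ij.2 (f x ij.1 ij.2).
  by apply: filter_forall => -[i j]; exact: fl (lP i j).
by apply: filterS => x Px; apply: PA => i j; exact: Px (i, j).
Qed.

Lemma mulmxr_continuous (p q r : nat) (A : 'M[R]_(q, r)) :
  continuous (mulmxr A : 'M[R]_(p, q) -> 'M[R]_(p, r)).
Proof.
move=> x; apply: (@cvg_mx _ (nbhs x) _) => i j.
under eq_fun do rewrite /= mxE.
rewrite /= mxE; apply: cvg_big => [|k _]; [exact: add_continuous|]; apply: cvgM; last exact: cvg_cst.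
exact: coord_continuous.
Qed.

Lemma Ck_row_mx (V : normedModType R) (m1 m2 k : nat) (U : set V)
    (f : V -> 'rV[R]_m1) (g : V -> 'rV[R]_m2) : open U ->
  Ck k U f -> Ck k U g -> Ck k U (fun x => row_mx (f x) (g x)).
Proof.
move=> oU hf hg.
pose L1 : {linear 'rV[R]_m1 -> 'rV[R]_(m1 + m2)} := mulmxr (row_mx 1%:M 0).
pose L2 : {linear 'rV[R]_m2 -> 'rV[R]_(m1 + m2)} := mulmxr (row_mx 0 1%:M).
have c1 : continuous L1 by exact: mulmxr_continuous.
have c2 : continuous L2 by exact: mulmxr_continuous.
apply: Ck_eq oU _ (CkD oU (Ck_lin_comp oU c1 hf) (Ck_lin_comp oU c2 hg)).
move=> x _ /=.
by rewrite !mul_mx_row !mulmx1 !mulmx0 add_row_mx addr0 add0r.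
Qed.

End Ck_lemmas.

(* [chart_inv] is only meaningful on the image of [chart_dom]. *)
Record chart (R : realType) (m : nat) (T : topologicalType) := Chart {
  chart_dom : set T ;
  chart_fun :> T -> 'rV[R]_m ;
  chart_inv : 'rV[R]_m -> T ;
  chart_dom_open : open chart_dom ;
  chart_im_open : open (chart_fun @` chart_dom) ;
  chart_funK : forall p, chart_dom p -> chart_inv (chart_fun p) = p ;
  chart_fun_cont : forall p, chart_dom p -> {for p, continuous chart_fun} ;
  chart_inv_cont : forall x, (chart_fun @` chart_dom) x ->
    {for x, continuous chart_inv} }.

(* Smooth manifolds without boundary, of dimension m. The atlas is
   {chart_at p | p in M}: as in any atlas a chart around each point can be
   chosen, every smooth structure is given by an atlas of this form. *)
Record manifold (R : realType) (m : nat) := Manifold {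
  manifold_sort :> topologicalType ;
  manifold_hausdorff : hausdorff_space manifold_sort ;
  manifold_second_countable : @second_countable manifold_sort ;
  chart_at : manifold_sort -> chart R m manifold_sort ;
  chart_at_dom : forall p, chart_dom (chart_at p) p ;
  chart_compat : forall p q,
    smooth_on
      (chart_at p @` (chart_dom (chart_at p) `&` chart_dom (chart_at q)))
      (chart_at q \o chart_inv (chart_at p)) }.

Section product_manifold.
Context {R : realType} {m1 m2 : nat}.

Section chart_lemmas.
Context {m : nat} {T : topologicalType} (phi : chart R m T).

Lemma chart_image (A : set T) :
  phi @` (chart_dom phi `&` A) =
  (phi @` chart_dom phi) `&` (chart_inv phi @^-1` A).
Proof.
apply/seteqP; split=> [_ [p [dp Ap] <-]|_ [[p dp <-]]] /=.
  by split; [exists p|rewrite /= chart_funK].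
by rewrite chart_funK// => Ap; exists p.
Qed.

Lemma chart_image_open (A : set T) : open A ->
  open (phi @` (chart_dom phi `&` A)).
Proof.
move=> oA; rewrite chart_image openE => x [xim xA].
rewrite /interior; apply: filterI.
  by apply: open_nbhs_nbhs; split=> //; exact: chart_im_open.
by apply: (chart_inv_cont xim); exact: open_nbhs_nbhs.
Qed.

Lemma chart_near (p : T) : chart_dom phi p ->
  \forall x \near phi p, phi (chart_inv phi x) = x.
Proof.
move=> dp; have : nbhs (phi p) (phi @` chart_dom phi).
  by apply: open_nbhs_nbhs; split; [exact: chart_im_open|exists p].
by apply: filterS => _ [q dq <-]; rewrite chart_funK.
Qed.
End chart_lemmas.

Section product_chart.
Context {T1 T2 : topologicalType} (phi1 : chart R m1 T1) (phi2 : chart R m2 T2).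

Definition prod_dom : set (T1 * T2) := chart_dom phi1 `*` chart_dom phi2.
Definition prod_fun (p : T1 * T2) : 'rV[R]_(m1 + m2) :=
  row_mx (phi1 p.1) (phi2 p.2).
Definition prod_inv (x : 'rV[R]_(m1 + m2)) : T1 * T2 :=
  (chart_inv phi1 (lsubmx x), chart_inv phi2 (rsubmx x)).

Lemma prod_dom_open : open prod_dom.
Proof.
rewrite openE => -[p q] [/= dp dq].
exists (chart_dom phi1, chart_dom phi2) => //; split; apply: open_nbhs_nbhs;
  by split=> //; exact: chart_dom_open.
Qed.

Lemma prod_fun_image (A : set T1) (B : set T2) :
  prod_fun @` ((chart_dom phi1 `&` A) `*` (chart_dom phi2 `&` B)) =
  (lsubmx @^-1` (phi1 @` (chart_dom phi1 `&` A))) `&`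
  (rsubmx @^-1` (phi2 @` (chart_dom phi2 `&` B))).
Proof.
apply/seteqP; split=> [_ [[p q] [/= hp hq] <-]|x [/= [p hp px] [q hq qx]]].
  rewrite /prod_fun; split; rewrite /= ?row_mxKl ?row_mxKr.
    by exists p.
  by exists q.
by exists (p, q) => //; rewrite /prod_fun /= px qx hsubmxK.
Qed.

Lemma lr_open (A : set 'rV[R]_m1) (B : set 'rV[R]_m2) : open A -> open B ->
  open ((lsubmx @^-1` A) `&` (rsubmx @^-1` B) : set 'rV[R]_(m1 + m2)).
Proof.
move=> oA oB; apply: openI; apply: open_comp => // x _.
  exact: continuous_lsubmx.
exact: continuous_rsubmx.
Qed.

Lemma prod_im_open : open (prod_fun @` prod_dom).
Proof.
rewrite /prod_dom -[chart_dom phi1]setIT -[chart_dom phi2]setIT prod_fun_image.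
by apply: lr_open; apply: chart_image_open; exact: openT.
Qed.

Lemma prod_funK p : prod_dom p -> prod_inv (prod_fun p) = p.
Proof.
case: p => p q [/= dp dq].
by rewrite /prod_inv /prod_fun /= row_mxKl row_mxKr !chart_funK.
Qed.

Lemma prod_fun_cont p : prod_dom p -> {for p, continuous prod_fun}.
Proof.
case: p => p q [/= dp dq]; apply: (@cvg_mx _ _ (nbhs (p, q)) _) => i j; rewrite /prod_fun.
under eq_fun do rewrite mxE; rewrite mxE /=.
case: (fintype.split j) => k.
- apply: (@cvg_comp _ _ _ fst (fun p => phi1 p i k)); first exact: cvg_fst.
  apply: (@cvg_comp _ _ _ phi1 (fun M : 'rV_m1 => M i k)).
    exact: chart_fun_cont.
  exact: coord_continuous.
- apply: (@cvg_comp _ _ _ snd (fun p => phi2 p i k)); first exact: cvg_snd.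
  apply: (@cvg_comp _ _ _ phi2 (fun M : 'rV_m2 => M i k)).
    exact: chart_fun_cont.
  exact: coord_continuous.
Qed.

Lemma prod_inv_cont x : (prod_fun @` prod_dom) x ->
  {for x, continuous prod_inv}.
Proof.
case=> -[p q] [/= dp dq] <-.
have c1 : {for prod_fun (p, q), continuous (chart_inv phi1 \o lsubmx)}.
  apply: continuous_comp; first exact: continuous_lsubmx.
  by rewrite row_mxKl; apply: chart_inv_cont; exists p.
have c2 : {for prod_fun (p, q), continuous (chart_inv phi2 \o rsubmx)}.
  apply: continuous_comp; first exact: continuous_rsubmx.
  by rewrite row_mxKr; apply: chart_inv_cont; exists q.
exact: (cvg_pair (F := nbhs (prod_fun (p, q))) c1 c2).
Qed.

Definition prod_chart : chart R (m1 + m2) (T1 * T2)%type :=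
  Chart prod_dom_open prod_im_open prod_funK prod_fun_cont prod_inv_cont.
End product_chart.

Lemma prod_hausdorff (T1 T2 : topologicalType) :
  hausdorff_space T1 -> hausdorff_space T2 -> hausdorff_space (T1 * T2)%type.
Proof.
move=> h1 h2 [p1 p2] [q1 q2] cl; congr (_, _).
- apply: h1 => A B pA qB.
  have [] := cl (fst @^-1` A) (fst @^-1` B).
  + exact: (@cvg_fst _ _ (nbhs p1) (nbhs p2)).
  + exact: (@cvg_fst _ _ (nbhs q1) (nbhs q2)).
  by move=> x [xA xB]; exists x.1.
- apply: h2 => A B pA qB.
  have [] := cl (snd @^-1` A) (snd @^-1` B).
  + exact: (@cvg_snd _ _ (nbhs p1) (nbhs p2)).
  + exact: (@cvg_snd _ _ (nbhs q1) (nbhs q2)).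
  by move=> x [xA xB]; exists x.2.
Qed.

Lemma prod_second_countable (T1 T2 : topologicalType) :
  @second_countable T1 -> @second_countable T2 ->
  @second_countable (T1 * T2)%type.
Proof.
move=> [B1 c1 [Bo1 b1]] [B2 c2 [Bo2 b2]].
exists ((fun AB : set T1 * set T2 => AB.1 `*` AB.2) @` (B1 `*` B2)).
  apply: card_le_trans (card_image_le _ _) _; exact: countableX.
split=> [_ [[A B] [/= hA hB] <-]|[p q] C [[/= A B] [/= pA qB] ABC]].
  rewrite openE => -[p q] [/= Ap Bq]; exists (A, B) => //=.
  by split; apply: open_nbhs_nbhs; split=> //; [exact: Bo1|exact: Bo2].
have [A' [/= B1A' A'p] A'A] := b1 p A pA.
have [B' [/= B2B' B'q] B'B] := b2 q B qB.
exists (A' `*` B'); first by split=> //; exists (A', B').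
by move=> [x y] [/= A'x B'y]; apply: ABC; split=> /=; [exact: A'A|exact: B'B].
Qed.

Variables (M1 : manifold R m1) (M2 : manifold R m2).

Let prod_at (p : M1 * M2) := prod_chart (chart_at p.1) (chart_at p.2).

Lemma prod_compat (p q : M1 * M2) :
  smooth_on (prod_at p @` (chart_dom (prod_at p) `&` chart_dom (prod_at q)))
    (prod_at q \o chart_inv (prod_at p)).
Proof.
move=> k /=.
have -> : prod_dom (chart_at p.1) (chart_at p.2) `&`
          prod_dom (chart_at q.1) (chart_at q.2) =
  (chart_dom (chart_at p.1) `&` chart_dom (chart_at q.1)) `*`
  (chart_dom (chart_at p.2) `&` chart_dom (chart_at q.2)).
  by apply/seteqP; split=> x /= [[a b] [c d]].
rewrite prod_fun_image.
have oU1 := @chart_image_open _ _ (chart_at p.1) _ (chart_dom_open (chart_at q.1)).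
have oU2 := @chart_image_open _ _ (chart_at p.2) _ (chart_dom_open (chart_at q.2)).
apply: Ck_row_mx; first exact: lr_open.
- have c := Ck_comp_lin (L := @lsubmx R 1 m1 m2) oU1
    (@continuous_lsubmx _ _ _ _) (chart_compat p.1 q.1 k).
  by apply: Ck_subset c; exact: subIsetl.
- have c := Ck_comp_lin (L := @rsubmx R 1 m1 m2) oU2
    (@continuous_rsubmx _ _ _ _) (chart_compat p.2 q.2 k).
  by apply: Ck_subset c; exact: subIsetr.
Qed.

Lemma prod_at_dom (p : M1 * M2) : chart_dom (prod_at p) p.
Proof. by split; exact: chart_at_dom. Qed.

Definition prod_manifold : manifold R (m1 + m2) :=
  Manifold
    (prod_hausdorff (@manifold_hausdorff _ _ M1) (@manifold_hausdorff _ _ M2))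
    (prod_second_countable (@manifold_second_countable _ _ M1)
       (@manifold_second_countable _ _ M2))
    prod_at_dom prod_compat.

End product_manifold.

Section geometry.
Context {R : realType}.

(* The chart [chart_at p] identifies T_pM with R^m. *)
Definition tangent {m : nat} {M : manifold R m} (p : M) : Type := 'rV[R]_m.

Definition vfield {m : nat} (M : manifold R m) : Type :=
  forall p : M, tangent p.

(* covariant 1- and 2-tensor fields; (multi)linearity is not built in *)
Definition tensor1 {m : nat} (M : manifold R m) : Type :=
  forall p : M, tangent p -> R.

Definition tensor2 {m : nat} (M : manifold R m) : Type :=
  forall p : M, tangent p -> tangent p -> R.

Definition dmap {m n : nat} {M : manifold R m} {N : manifold R n}
    (F : M -> N) (p : M) (v : tangent p) : tangent (F p) :=
  'd (chart_at (F p) \o F \o chart_inv (chart_at p)) (chart_at p p) v.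

Definition dfun {m : nat} {M : manifold R m} (f : M -> R) : tensor1 M :=
  fun p v => 'd (f \o chart_inv (chart_at p)) (chart_at p p) v.

(* coordinates of v in T_qM with respect to the chart [chart_at p] *)
Definition coord_in {m : nat} {M : manifold R m} (p q : M) (v : tangent q) :
    'rV[R]_m :=
  'd (chart_at p \o chart_inv (chart_at q)) (chart_at q q) v.

Definition smooth_fun {m : nat} {M : manifold R m} (U : set M) (f : M -> R) :=
  forall p : M, smooth_on (chart_at p @` (chart_dom (chart_at p) `&` U))
    (f \o chart_inv (chart_at p)).

Definition smooth_vfield {m : nat} {M : manifold R m} (U : set M)
    (X : vfield M) :=
  forall p : M, smooth_on (chart_at p @` (chart_dom (chart_at p) `&` U))
    ((fun q => coord_in p (X q)) \o chart_inv (chart_at p)).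

Record riemannian_metric {m : nat} {M : manifold R m} (g : tensor2 M) : Prop :=
  RiemannianMetric {
  metric_sym : forall (p : M) (v w : tangent p), g p v w = g p w v ;
  metric_linear : forall (p : M) (a : R) (v v' w : tangent p),
    g p (a *: v + v') w = a * g p v w + g p v' w ;
  metric_pos : forall (p : M) (v : tangent p), v != 0 -> 0 < g p v v ;
  metric_smooth : forall (U : set M) (X Y : vfield M), open U ->
    smooth_vfield U X -> smooth_vfield U Y ->
    smooth_fun U (fun p => g p (X p) (Y p)) }.

Definition tnorm {m : nat} {M : manifold R m} (g : tensor2 M) (p : M)
    (v : tangent p) : R := Num.sqrt (g p v v).

(* A field on the open set U is represented by a total one, whose values
   outside U are irrelevant. *)
Record local_frame {m : nat} {M : manifold R m} (U : set M)
    (X : 'I_m -> vfield M) : Prop := LocalFrame {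
  frame_open : open U ;
  frame_smooth : forall i, smooth_vfield U (X i) ;
  frame_basis : forall p, U p -> (\matrix_(i < m) (X i p : 'rV[R]_m)) \in unitmx }.

Record local_orthonormal_frame {m : nat} {M : manifold R m} (g : tensor2 M)
    (U : set M) (X : 'I_m -> vfield M) : Prop := LocalOrthonormalFrame {
  onframe_frame : local_frame U X ;
  onframe_orthonormal : forall p, U p ->
    forall i j, g p (X i p) (X j p) = (i == j)%:R }.

Definition pullback {m n : nat} {M : manifold R m} {N : manifold R n}
    (F : M -> N) (g : tensor2 N) : tensor2 M :=
  fun p v w => g (F p) (dmap F v) (dmap F w).

Definition odot {m : nat} {M : manifold R m} (a b : tensor1 M) : tensor2 M :=
  fun p v w => a p v * b p w + b p v * a p w.

Section product.
Context {m1 m2 : nat} {M1 : manifold R m1} {M2 : manifold R m2}.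
Let M := prod_manifold M1 M2.

Definition proj1 : M -> M1 := fst.
Definition proj2 : M -> M2 := snd.

Definition hlift_fun (f : M1 -> R) : M -> R := f \o proj1.
Definition vlift_fun (f : M2 -> R) : M -> R := f \o proj2.

(* [get] picks an element of a set; these sets are singletons, see [hliftP],
   [hliftE] and [vliftP], [vliftE]. *)
Definition hlift (X : vfield M1) : vfield M := fun p =>
  get [set v : 'rV[R]_(m1 + m2) |
    @dmap _ _ M M1 proj1 p v = X (proj1 p) /\ @dmap _ _ M M2 proj2 p v = 0].

Definition vlift (X : vfield M2) : vfield M := fun p =>
  get [set v : 'rV[R]_(m1 + m2) |
    @dmap _ _ M M1 proj1 p v = 0 /\ @dmap _ _ M M2 proj2 p v = X (proj2 p)].

Lemma dmap_proj1 (p : M) (v : tangent p) : dmap proj1 v = lsubmx v.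
Proof.
rewrite /dmap.
have cl : continuous (@lsubmx R 1 m1 m2) by move=> x; exact: continuous_lsubmx.
have n1 : {near chart_at p p, (@lsubmx R 1 m1 m2) =1
   (chart_at (proj1 p) \o proj1 \o chart_inv (chart_at p))}.
  have e : lsubmx (chart_at p p) = chart_at p.1 p.1 by exact: row_mxKl.
  have := chart_near (chart_at_dom p.1); rewrite -e => h.
  have h1 := cl _ _ h.
  by move: h1; apply: (@filterS _ (nbhs (chart_at p p)) _) => x /= ->.
have dl := linear_differentiable (chart_at p p) cl.
by have [_ ->] := near_eq_diff n1 dl; rewrite diff_lin.
Qed.

Lemma dmap_proj2 (p : M) (v : tangent p) : dmap proj2 v = rsubmx v.
Proof.
rewrite /dmap.
have cr : continuous (@rsubmx R 1 m1 m2) by move=> x; exact: continuous_rsubmx.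
have n2 : {near chart_at p p, (@rsubmx R 1 m1 m2) =1
   (chart_at (proj2 p) \o proj2 \o chart_inv (chart_at p))}.
  have e : rsubmx (chart_at p p) = chart_at p.2 p.2 by exact: row_mxKr.
  have := chart_near (chart_at_dom p.2); rewrite -e => h.
  have h2 := cr _ _ h.
  by move: h2; apply: (@filterS _ (nbhs (chart_at p p)) _) => x /= ->.
have dr := linear_differentiable (chart_at p p) cr.
by have [_ ->] := near_eq_diff n2 dr; rewrite diff_lin.
Qed.

Lemma hliftP (X : vfield M1) (p : M) :
  dmap proj1 (hlift X p) = X (proj1 p) /\ dmap proj2 (hlift X p) = 0.
Proof.
apply: (@getPex _ [set v : 'rV[R]_(m1 + m2) |
  @dmap _ _ M M1 proj1 p v = X (proj1 p) /\ @dmap _ _ M M2 proj2 p v = 0]).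
exists (row_mx (X (proj1 p)) 0).
by rewrite /= dmap_proj1 dmap_proj2 row_mxKl row_mxKr.
Qed.

Lemma vliftP (X : vfield M2) (p : M) :
  dmap proj1 (vlift X p) = 0 /\ dmap proj2 (vlift X p) = X (proj2 p).
Proof.
apply: (@getPex _ [set v : 'rV[R]_(m1 + m2) |
  @dmap _ _ M M1 proj1 p v = 0 /\ @dmap _ _ M M2 proj2 p v = X (proj2 p)]).
exists (row_mx 0 (X (proj2 p))).
by rewrite /= dmap_proj1 dmap_proj2 row_mxKl row_mxKr.
Qed.

Lemma hliftE (X : vfield M1) (p : M) :
  hlift X p = row_mx (X (proj1 p)) 0 :> 'rV[R]_(m1 + m2).
Proof.
have [] := hliftP X p; rewrite dmap_proj1 dmap_proj2 => e1 e2.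
by rewrite -[LHS]hsubmxK e1 e2.
Qed.

Lemma vliftE (X : vfield M2) (p : M) :
  vlift X p = row_mx 0 (X (proj2 p)) :> 'rV[R]_(m1 + m2).
Proof.
have [] := vliftP X p; rewrite dmap_proj1 dmap_proj2 => e1 e2.
by rewrite -[LHS]hsubmxK e1 e2.
Qed.

Definition metric_h (c : R) (g1 : tensor2 M1) (g2 : tensor2 M2)
    (f1 : M1 -> R) (f2 : M2 -> R) : tensor2 M := fun p v w =>
  pullback proj1 g1 v w
  + hlift_fun f1 p ^+ 2 * pullback proj2 g2 v w
  + c ^+ 2 / 2 * vlift_fun f2 p ^+ 2
    * odot (dfun (hlift_fun f1)) (dfun (hlift_fun f1)) v w.

(* Indices start at 0, so that the sums over j < k below with k = i and
   k = i.+1 are B_i and B_(i+1) for an index starting at 1. *)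
Definition frame_a (e : 'I_m1 -> vfield M1) (f : M1 -> R) (i : 'I_m1) (p : M1) :
    R := dfun f (e i p).

Definition frame_B (e : 'I_m1 -> vfield M1) (f : M1 -> R) (k : nat) (p : M1) :
    R := \sum_(j < m1 | (j < k)%N) frame_a e f j p ^+ 2.

Definition frame_T (e : 'I_m1 -> vfield M1) (f : M1 -> R) (k : nat) :
    vfield M1 := fun p =>
  \sum_(j < m1 | (j < k)%N) frame_a e f j p *: (e j p : 'rV[R]_m1).

Definition frame_u' (c : R) (f1 : M1 -> R) (f2 : M2 -> R)
    (e1 : 'I_m1 -> vfield M1) (e2 : 'I_m2 -> vfield M2)
    (i : 'I_(m1 + m2)) : vfield M := fun p =>
  match fintype.split i with
  | inl i => - ((c * vlift_fun f2 p) ^+ 2 * hlift_fun (frame_a e1 f1 i) p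
               / (1 + (c * vlift_fun f2 p) ^+ 2 * hlift_fun (frame_B e1 f1 i) p))
               *: (hlift (frame_T e1 f1 i) p : 'rV[R]_(m1 + m2))
             + hlift (e1 i) p
  | inr i => (hlift_fun f1 p)^-1 *: (vlift (e2 i) p : 'rV[R]_(m1 + m2))
  end.

Definition frame_u (c : R) (g1 : tensor2 M1) (g2 : tensor2 M2)
    (f1 : M1 -> R) (f2 : M2 -> R)
    (e1 : 'I_m1 -> vfield M1) (e2 : 'I_m2 -> vfield M2)
    (i : 'I_(m1 + m2)) : vfield M := fun p =>
  let u' := frame_u' c f1 f2 e1 e2 i p in
  if fintype.split i is inl _
  then (tnorm (metric_h c g1 g2 f1 f2) u')^-1 *: (u' : 'rV[R]_(m1 + m2))
  else u'.

End product.
End geometry.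

(* Main.v *)
(* With t = (c f_2)^2 the metric restricted to horizontal vectors is the rank-one
   perturbation g_1 + t df_1 (x) df_1, since the factor 1/2 cancels against the
   symmetrisation in the odot product. The u'_i are its Gram-Schmidt
   orthogonalisation of the e_i: df_1 (u'_i) = a_i / (1 + t B_i), while
   g_1 (u'_i, T_k) has the same value for i < k, so that the correction
   -t a_k / (1 + t B_k) T_k in u'_k cancels the perturbation term. *)
Require Import Defs.
From HB Require Import structures.
From mathcomp Require Import all_boot all_order all_algebra.
From mathcomp Require Import all_classical all_reals all_analysis.
From mathcomp Require Import ring lra.

Set Implicit Arguments.
Unset Strict Implicit.
Unset Printing Implicit Defensive.

Import Order.TTheory GRing.Theory Num.Theory.
Import numFieldNormedType.Exports.

Local Open Scope classical_set_scope.
Local Open Scope ring_scope.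

(** * Calculus of C^k maps *)

Section Ck_calculus.
Context {R : realType}.
Implicit Types V W : normedModType R.

(** The Leibniz and chain rules express a derivative through the undifferentiated functions as well,
    so an induction on [k] has to lower their order by one before its hypothesis applies. *)
Lemma Ck_pred V W k (U : set V) (f : V -> W) : Ck k.+1 U f -> Ck k U f.
Proof.
elim: k f => [|k IH] f [df Df].
  by move=> x Ux; apply: differentiable_continuous; exact: df.
by split=> // v; exact: IH (Df v).
Qed.

Lemma Ck_cst V W k (U : set V) (w : W) : Ck k U (fun=> w).
Proof.
elim: k w => [|k IH] w /=; first by move=> x _; exact: cvg_cst.
split=> [x _|v]; first exact: differentiable_cst.
suff -> : (fun x : V => 'D_v (fun=> w) x) = fun=> 0 by exact: IH.
by apply/funext => x; rewrite (derive_cst w).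
Qed.

Lemma CkM V k (U : set V) (f g : V -> R) : open U ->
  Ck k U f -> Ck k U g -> Ck k U (fun x => f x * g x).
Proof.
move=> oU; elim: k f g => [|k IH] f g.
  by move=> hf hg x Ux; apply: cvgM; [exact: hf|exact: hg].
move=> cf cg; have [df Df] := cf; have [dg Dg] := cg; split=> [x Ux|v].
  by apply: differentiableM; [exact: df|exact: dg].
apply: Ck_eq oU _ (CkD oU (IH _ _ (Ck_pred cf) (Dg v))
                          (IH _ _ (Ck_pred cg) (Df v))) => x Ux.
by rewrite deriveM//; apply: diff_derivable; [exact: df|exact: dg].
Qed.

Lemma Ck_sum V W k (U : set V) (I : Type) (r : seq I) (P : pred I)
    (F : I -> V -> W) : open U ->
  (forall i, P i -> Ck k U (F i)) -> Ck k U (fun x => \sum_(i <- r | P i) F i x).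
Proof.
move=> oU CF; elim: r => [|i r IH].
  by apply: Ck_eq oU _ (Ck_cst k U 0) => x _; rewrite big_nil.
have [Pi|nPi] := boolP (P i).
  by apply: Ck_eq oU _ (CkD oU (CF _ Pi) IH) => x _; rewrite big_cons Pi.
by apply: Ck_eq oU _ IH => x _; rewrite big_cons (negbTE nPi).
Qed.

(** With a constant vector [w] the derivative keeps the same form and the induction closes.
    Expanding row vectors in the standard basis then reduces maps into ['rV[R]_n] to their
    coordinates, and [CkZ] to the scalar product rule. *)
Lemma CkZl V W k (U : set V) (f : V -> R) (w : W) : open U ->
  Ck k U f -> Ck k U (fun x => f x *: w).
Proof.
move=> oU; elim: k f => [|k IH] f /=.
  by move=> hf x Ux; apply: cvgZr_tmp; exact: hf.
move=> [df Df]; split=> [x Ux|v]; first by apply: differentiableZl; exact: df.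
apply: Ck_eq oU _ (IH _ (Df v)) => x Ux; have dfx := df x Ux.
by rewrite [RHS](deriveE _ (differentiableZl w dfx)) (deriveE _ dfx) diffZl.
Qed.

Lemma Ck_coord V n k (U : set V) (F : V -> 'rV[R]_n) j : open U ->
  Ck k U F -> Ck k U (fun x => F x 0 j).
Proof.
move=> oU CF.
have lin : linear (fun v : 'rV[R]_n => v 0 j : R) by move=> a v w; rewrite !mxE.
pose L : {linear 'rV[R]_n -> R} :=
  HB.pack (fun v : 'rV[R]_n => v 0 j : R) (GRing.isLinear.Build _ _ _ _ _ lin).
by apply: (Ck_lin_comp (L := L) oU _ CF); exact: coord_continuous.
Qed.

Lemma Ck_rV V n k (U : set V) (F : V -> 'rV[R]_n) : open U ->
  (forall j, Ck k U (fun x => F x 0 j)) -> Ck k U F.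
Proof.
move=> oU CF; apply: (Ck_eq oU (f := fun x => \sum_j F x 0 j *: delta_mx 0 j)).
  by move=> x _; rewrite [RHS]row_sum_delta.
by apply: (Ck_sum _ (F := fun j x => F x 0 j *: delta_mx 0 j)) => // j _; apply: CkZl.
Qed.

Lemma CkZ V n k (U : set V) (f : V -> R) (F : V -> 'rV[R]_n) : open U ->
  Ck k U f -> Ck k U F -> Ck k U (fun x => f x *: F x).
Proof.
move=> oU Cf CF; apply: Ck_rV => // j.
apply: Ck_eq oU _ (CkM oU Cf (Ck_coord j oU CF)) => x _.
by rewrite mxE.
Qed.

(** The derivative is written as a multiple of the cube of the function itself, so that the
    induction in [Ck_invsqrt] involves no other power of [f]. *)
Lemma is_derive_invsqrt (y : R) : 0 < y ->
  is_derive y 1 (fun z => (Num.sqrt z)^-1) (- 2^-1 * (Num.sqrt y)^-1 ^+ 3).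
Proof.
move=> y0; have s0 : Num.sqrt y != 0 by rewrite gt_eqF// sqrtr_gt0.
have ds := is_derive1_sqrt y0.
apply: is_derive_eq.
by rewrite /GRing.scale /=; field.
Qed.

Lemma Ck_invsqrt V k (U : set V) (f : V -> R) : open U ->
  (forall x, U x -> 0 < f x) -> Ck k U f ->
  Ck k U (fun x => (Num.sqrt (f x))^-1).
Proof.
move=> oU f0; elim: k => [|k IH] Cf.
  move=> x Ux; apply: cvgV; first by rewrite gt_eqF// sqrtr_gt0 f0.
  apply: (continuous_comp (Cf x Ux)); exact: sqrt_continuous.
have [df Df] := Cf; have Cs := IH (Ck_pred Cf).
have dg x : U x -> differentiable (fun z : R => (Num.sqrt z)^-1) (f x).
  by move=> Ux; apply/derivable1_diffP; have := is_derive_invsqrt (f0 x Ux); case.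
have dc x (Ux : U x) := differentiable_comp (df x Ux) (dg x Ux).
split=> // v.
(* This is the chain rule: the derivative of f^(-1/2) along v is -1/2 times the cube of f^(-1/2)
   times the derivative of f, and f^(-1/2) is of class C^k by induction. *)
have CD := CkM oU (CkM oU (Ck_cst k U (- 2^-1 : R)) (CkM oU Cs (CkM oU Cs Cs))) (Df v).
apply: Ck_eq oU _ CD => x Ux.
rewrite [RHS](deriveE _ (dc x Ux)) (diff_comp (df x Ux) (dg x Ux)) /=.
rewrite -(deriveE _ (df x Ux)) (diff1E (dg x Ux)) derive1E.
have [_ ->] := is_derive_invsqrt (f0 x Ux).
by rewrite /GRing.scale /= mulrC !exprS expr0 mulr1.
Qed.

End Ck_calculus.

(** * Smooth functions and vector fields on a manifold *)

Section manifold_calculus.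
Context {R : realType} {m : nat} {M : manifold R m}.
Implicit Types (U : set M) (f g : M -> R) (X Y : vfield M) (p q : M).

Lemma chart_diff p q : chart_dom (chart_at p) q ->
  differentiable (chart_at p \o chart_inv (chart_at q)) (chart_at q q).
Proof.
move=> dpq; have [+ _] := chart_compat q p 1; apply.
by exists q => //; split=> //; exact: chart_at_dom.
Qed.

Lemma smooth_fun_diff U f p q : smooth_fun U f ->
  chart_dom (chart_at p) q -> U q ->
  differentiable (f \o chart_inv (chart_at p)) (chart_at p q).
Proof. by move=> sf dpq Uq; have [+ _] := sf p 1; apply; exists q. Qed.

(** [dfun] at [q] is computed in [chart_at q], which varies with [q] in no controlled way.
    Smoothness has to be read in one fixed chart, and the chain rule for the transition map passes
    to it. *)
Lemma dfun_coord_in U f p q (v : tangent q) : smooth_fun U f ->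
  chart_dom (chart_at p) q -> U q ->
  dfun f v = 'd (f \o chart_inv (chart_at p)) (chart_at p q) (coord_in p v).
Proof.
move=> sf dpq Uq; have qK := chart_funK (chart_at_dom q).
set F := f \o _; set h := chart_at p \o chart_inv (chart_at q).
have hq : h (chart_at q q) = chart_at p q by rewrite /h /= qK.
have dh : differentiable h (chart_at q q) by exact: chart_diff.
have dF : differentiable F (h (chart_at q q)).
  by rewrite hq; exact: smooth_fun_diff sf dpq Uq.
(* Chart inverses are meaningful only on chart images, so the two local expressions agree just on
   the image of the overlap; this open set contains the base point, which suffices for equal
   differentials. *)
have n : {near chart_at q q, F \o h =1 f \o chart_inv (chart_at q)}.
  have oA := chart_image_open (phi := chart_at q) (chart_dom_open (chart_at p)).
  have : nbhs (chart_at q q)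
      (chart_at q @` (chart_dom (chart_at q) `&` chart_dom (chart_at p))).
    apply: open_nbhs_nbhs; split=> //.
    by exists q => //; split=> //; exact: chart_at_dom.
  apply: filterS => _ [r [dq dp] <-].
  by rewrite /F /h /= chart_funK// chart_funK.
have [_ e] := near_eq_diff n (differentiable_comp dh dF).
rewrite -[LHS]/('d (f \o chart_inv (chart_at q)) (chart_at q q) v).
rewrite -hq.
transitivity ('d (F \o h) (chart_at q q) v).
  exact: (congr1 (@^~ v) e).
exact: (congr1 (@^~ v) (diff_comp dh dF)).
Qed.

Lemma smooth_fun_eq U f g : open U -> (forall p, U p -> f p = g p) ->
  smooth_fun U f -> smooth_fun U g.
Proof.
move=> oU fg sf p k; apply: Ck_eq (sf p k); first exact: chart_image_open.
by move=> _ [q [dq Uq] <-] /=; rewrite chart_funK// fg.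
Qed.

Lemma smooth_fun_subset (U U' : set M) f : U' `<=` U ->
  smooth_fun U f -> smooth_fun U' f.
Proof.
move=> UU' sf p k; apply: Ck_subset (sf p k).
by apply: image_subset; exact: setIS.
Qed.

Lemma smooth_fun_cst U a : smooth_fun U (fun=> a).
Proof. by move=> p k; exact: Ck_cst. Qed.

Lemma smooth_funD U f g : open U -> smooth_fun U f -> smooth_fun U g ->
  smooth_fun U (fun p => f p + g p).
Proof.
by move=> oU sf sg p k; apply: CkD (sf p k) (sg p k); exact: chart_image_open.
Qed.

Lemma smooth_funM U f g : open U -> smooth_fun U f -> smooth_fun U g ->
  smooth_fun U (fun p => f p * g p).
Proof.
by move=> oU sf sg p k; apply: CkM (sf p k) (sg p k); exact: chart_image_open.
Qed.

Lemma smooth_fun_sum U (I : Type) (r : seq I) (P : pred I) (F : I -> M -> R) :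
  open U -> (forall i, P i -> smooth_fun U (F i)) ->
  smooth_fun U (fun p => \sum_(i <- r | P i) F i p).
Proof.
move=> oU sF p k; apply: (Ck_sum _ (F := fun i => F i \o chart_inv (chart_at p))).
  exact: chart_image_open.
by move=> i Pi; exact: sF.
Qed.

Lemma smooth_fun_invsqrt U f : open U -> (forall p, U p -> 0 < f p) ->
  smooth_fun U f -> smooth_fun U (fun p => (Num.sqrt (f p))^-1).
Proof.
move=> oU f0 sf p k; apply: Ck_invsqrt (sf p k); first exact: chart_image_open.
by move=> _ [q [dq Uq] <-] /=; rewrite chart_funK// f0.
Qed.

(** For positive f, 1/f is the square of 1/sqrt f, so the induction for the inverse square root
    covers both kinds of inverse. *)
Lemma smooth_funV U f : open U -> (forall p, U p -> 0 < f p) ->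
  smooth_fun U f -> smooth_fun U (fun p => (f p)^-1).
Proof.
move=> oU f0 sf; have s := smooth_fun_invsqrt oU f0 sf.
apply: smooth_fun_eq oU _ (smooth_funM oU s s) => p Up.
by rewrite -invfM -expr2 sqr_sqrtr// ltW// f0.
Qed.

Lemma smooth_vfield_eq U X Y : open U -> (forall p, U p -> X p = Y p) ->
  smooth_vfield U X -> smooth_vfield U Y.
Proof.
move=> oU XY sX p k; apply: Ck_eq (sX p k); first exact: chart_image_open.
by move=> _ [q [dq Uq] <-] /=; rewrite chart_funK// XY.
Qed.

Lemma smooth_vfieldD U X Y : open U -> smooth_vfield U X -> smooth_vfield U Y ->
  smooth_vfield U (fun p => (X p : 'rV[R]_m) + Y p).
Proof.
move=> oU sX sY p k; have oA := chart_image_open (phi := chart_at p) oU.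
by apply: Ck_eq oA _ (CkD oA (sX p k) (sY p k)) => x _; rewrite /coord_in /= linearD.
Qed.

Lemma smooth_vfieldZ U f X : open U -> smooth_fun U f -> smooth_vfield U X ->
  smooth_vfield U (fun p => f p *: (X p : 'rV[R]_m)).
Proof.
move=> oU sf sX p k; have oA := chart_image_open (phi := chart_at p) oU.
by apply: Ck_eq oA _ (CkZ oA (sf p k) (sX p k)) => x _; rewrite /coord_in /= linearZ.
Qed.

Lemma smooth_vfield_sum U (I : Type) (r : seq I) (P : pred I)
    (F : I -> vfield M) : open U ->
  (forall i, P i -> smooth_vfield U (F i)) ->
  smooth_vfield U (fun p => \sum_(i <- r | P i) (F i p : 'rV[R]_m)).
Proof.
move=> oU sF p k; have oA := chart_image_open (phi := chart_at p) oU.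
apply: Ck_eq oA _ (Ck_sum r oA (fun i Pi => sF i Pi p k)) => x _.
by rewrite /coord_in /= linear_sum.
Qed.

(** In a fixed chart df(X) is the sum of the components of X times the partial derivatives of f. The
    latter are of class C^k because f is of class C^(k+1). *)
Lemma smooth_dfun U f X : open U -> smooth_fun U f -> smooth_vfield U X ->
  smooth_fun U (fun p => dfun f (X p)).
Proof.
move=> oU sf sX p k; have oA := chart_image_open (phi := chart_at p) oU.
set F := f \o chart_inv (chart_at p).
pose E x : 'rV[R]_m := coord_in p (X (chart_inv (chart_at p) x)).
apply: (Ck_eq (f := fun x => \sum_j E x 0 j * 'D_(delta_mx 0 j) F x) oA).
  move=> _ [q [dq Uq] <-] /=; rewrite /E chart_funK//.
  rewrite (dfun_coord_in _ sf dq Uq) [in RHS](row_sum_delta (coord_in p (X q))).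
  rewrite linear_sum; apply: eq_bigr => j _.
  by rewrite deriveE ?linearZ//; exact: smooth_fun_diff sf dq Uq.
apply: (Ck_sum _ (F := fun j x => E x 0 j * _)) => // j _.
apply: CkM (oA) (Ck_coord j oA (sX p k)) _.
by have [_] := sf p k.+1; apply.
Qed.

End manifold_calculus.

(** * Lifts to a product manifold *)

Section diff_linear.
Context {R : realType} {V W Z : normedModType R}.

Lemma diff_lin_comp (L : {linear W -> Z}) (f : V -> W) x v : continuous L ->
  differentiable f x -> 'd (L \o f) x v = L ('d f x v).
Proof.
move=> cL df; have dL : differentiable L (f x) by exact: linear_differentiable.
by rewrite (diff_comp df dL) /= diff_lin.
Qed.

Lemma diff_comp_lin (L : {linear V -> W}) (f : W -> Z) x v : continuous L ->
  differentiable f (L x) -> 'd (f \o L) x v = 'd f (L x) (L v).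
Proof.
move=> cL df; have dL : differentiable L x by exact: linear_differentiable.
by rewrite (diff_comp dL df) /= diff_lin.
Qed.

End diff_linear.

Section product_calculus.
Context {R : realType} {m1 m2 : nat} {M1 : manifold R m1} {M2 : manifold R m2}.
Let M := prod_manifold M1 M2.
Implicit Types (A : set M1) (B : set M2) (X : vfield M1) (Y : vfield M2).

Lemma open_setX A B : open A -> open B -> open (A `*` B : set M).
Proof.
move=> o1 o2; rewrite openE => -[p q] [/= Ap Bq].
by exists (A, B) => //; split; apply: open_nbhs_nbhs.
Qed.

Lemma prod_chart_image A B (p : M) :
  chart_at p @` (chart_dom (chart_at p) `&` (A `*` B)) =
  (lsubmx @^-1` (chart_at p.1 @` (chart_dom (chart_at p.1) `&` A))) `&`
  (rsubmx @^-1` (chart_at p.2 @` (chart_dom (chart_at p.2) `&` B))).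
Proof.
rewrite -prod_fun_image; congr (_ @` _).
by apply/seteqP; split=> x [[a b] [d e]].
Qed.

(** In product charts the first projection is the linear map [lsubmx], so lifting a function from
    the first factor is composition with a continuous linear map. *)
Lemma Ck_prod_lsubmx (V : normedModType R) k A B (p : M) (f : 'rV[R]_m1 -> V) :
  open A -> Ck k (chart_at p.1 @` (chart_dom (chart_at p.1) `&` A)) f ->
  Ck k (chart_at p @` (chart_dom (chart_at p) `&` (A `*` B)))
    (fun x => f (lsubmx x)).
Proof.
move=> o1 Cf; rewrite prod_chart_image; apply: Ck_subset; first exact: subIsetl.
apply: (Ck_comp_lin (L := @lsubmx R 1 m1 m2)) Cf; first exact: chart_image_open.
exact: continuous_lsubmx.
Qed.

Lemma Ck_prod_rsubmx (V : normedModType R) k A B (p : M) (f : 'rV[R]_m2 -> V) :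
  open B -> Ck k (chart_at p.2 @` (chart_dom (chart_at p.2) `&` B)) f ->
  Ck k (chart_at p @` (chart_dom (chart_at p) `&` (A `*` B)))
    (fun x => f (rsubmx x)).
Proof.
move=> o2 Cf; rewrite prod_chart_image; apply: Ck_subset; first exact: subIsetr.
apply: (Ck_comp_lin (L := @rsubmx R 1 m1 m2)) Cf; first exact: chart_image_open.
exact: continuous_rsubmx.
Qed.

Lemma smooth_hlift_fun A B (f : M1 -> R) : open A -> smooth_fun A f ->
  smooth_fun (A `*` B : set M) (hlift_fun f).
Proof. by move=> o1 sf p k; exact: Ck_prod_lsubmx o1 (sf p.1 k). Qed.

Lemma smooth_vlift_fun A B (f : M2 -> R) : open B -> smooth_fun B f ->
  smooth_fun (A `*` B : set M) (vlift_fun f).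
Proof. by move=> o2 sf p k; exact: Ck_prod_rsubmx o2 (sf p.2 k). Qed.

(** A transition map between product charts is the product of the transition maps of the factors,
    hence its differential is block diagonal. *)
Lemma coord_in_prod (p q : M) (v : tangent q) : chart_dom (chart_at p) q ->
  coord_in p v = row_mx (coord_in p.1 (lsubmx v : tangent q.1))
                        (coord_in p.2 (rsubmx v : tangent q.2)).
Proof.
move=> dpq; have [dpq1 dpq2] := dpq.
have cl : continuous (@lsubmx R 1 m1 m2) by move=> x; exact: continuous_lsubmx.
have cr : continuous (@rsubmx R 1 m1 m2) by move=> x; exact: continuous_rsubmx.
have dH := chart_diff dpq; set H := _ \o _ in dH.
have d1 := chart_diff dpq1; set h1 := _ \o _ in d1.
have d2 := chart_diff dpq2; set h2 := _ \o _ in d2.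
have e1 : lsubmx \o H = h1 \o lsubmx by apply/funext => x; exact: row_mxKl.
have e2 : rsubmx \o H = h2 \o rsubmx by apply/funext => x; exact: row_mxKr.
have q1 : lsubmx (chart_at q q) = chart_at q.1 q.1 by exact: row_mxKl.
have q2 : rsubmx (chart_at q q) = chart_at q.2 q.2 by exact: row_mxKr.
rewrite -[LHS]hsubmxK; congr row_mx.
- transitivity ('d (lsubmx \o H) (chart_at q q) v); first by rewrite diff_lin_comp.
  rewrite e1; transitivity ('d h1 (lsubmx (chart_at q q)) (lsubmx v)).
    by apply: diff_comp_lin => //; exact: (eq_ind_r (fun x => differentiable h1 x) d1 q1).
  by rewrite q1.
- transitivity ('d (rsubmx \o H) (chart_at q q) v); first by rewrite diff_lin_comp.
  rewrite e2; transitivity ('d h2 (rsubmx (chart_at q q)) (rsubmx v)).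
    by apply: diff_comp_lin => //; exact: (eq_ind_r (fun x => differentiable h2 x) d2 q2).
  by rewrite q2.
Qed.

(** By the block form of [coord_in_prod], the components of the lift in a product chart are those of
    [X] followed by zeros. *)
Lemma smooth_hlift A B X : open A -> open B -> smooth_vfield A X ->
  smooth_vfield (A `*` B : set M) (hlift X).
Proof.
move=> o1 o2 sX p k; have oU := open_setX o1 o2.
have oA := chart_image_open (phi := chart_at p) oU.
apply: Ck_eq oA _ (Ck_row_mx oA (Ck_prod_lsubmx B o1 (sX p.1 k))
  (Ck_cst k _ (0 : 'rV[R]_m2))).
move=> _ [q [dq Uq] <-]; rewrite /comp chart_funK// coord_in_prod// hliftE.
by rewrite row_mxKl row_mxKr /coord_in linear0 [lsubmx _]row_mxKl chart_funK//; case: dq.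
Qed.

Lemma smooth_vlift A B Y : open A -> open B -> smooth_vfield B Y ->
  smooth_vfield (A `*` B : set M) (vlift Y).
Proof.
move=> o1 o2 sX p k; have oU := open_setX o1 o2.
have oA := chart_image_open (phi := chart_at p) oU.
apply: Ck_eq oA _ (Ck_row_mx oA (Ck_cst k _ (0 : 'rV[R]_m1))
  (Ck_prod_rsubmx A o2 (sX p.2 k))).
move=> _ [q [dq Uq] <-]; rewrite /comp chart_funK// coord_in_prod// vliftE.
by rewrite row_mxKl row_mxKr /coord_in linear0 [rsubmx _]row_mxKr chart_funK//; case: dq.
Qed.

(** The local expression of the lifted function is, by conversion, that of [f] composed with
    [lsubmx]; the chain rule with a linear inner map then applies. *)
Lemma dfun_hlift_fun (f : M1 -> R) (p : M) (v : tangent p) :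
  smooth_fun setT f ->
  dfun (hlift_fun f) v = dfun f (lsubmx v : tangent p.1).
Proof.
move=> sf.
have cl : continuous (@lsubmx R 1 m1 m2) by move=> x; exact: continuous_lsubmx.
have p1 : lsubmx (chart_at p p) = chart_at p.1 p.1 by exact: row_mxKl.
have df : differentiable (f \o chart_inv (chart_at p.1)) (lsubmx (chart_at p p)).
  by rewrite p1; apply: smooth_fun_diff sf (chart_at_dom _) _.
rewrite [RHS]/dfun -p1.
exact: diff_comp_lin cl df.
Qed.

End product_calculus.

(** * Gram-Schmidt for a rank-one perturbation *)

Section rank_one_gram.
Context {R : realType} {m : nat} (G : 'rV[R]_m -> 'rV[R]_m -> R).
Hypothesis Gsym : forall v w, G v w = G w v.
Hypothesis Glin : forall a v v' w, G (a *: v + v') w = a * G v w + G v' w.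
Context (d : {linear 'rV[R]_m -> R}) (n : nat) (e : 'I_n -> 'rV[R]_m).
Hypothesis Ge : forall i j, G (e i) (e j) = (i == j)%:R.
Context (t : R).
Hypothesis t_ge0 : 0 <= t.

(** These are the values at one point of [frame_a], [frame_B], [frame_T] and of the first block of
    [frame_u'], with [d] for df_1 and [t] for (c f_2)^2. *)
Let a i := d (e i).
Let B (k : nat) := \sum_(j < n | (j < k)%N) a j ^+ 2.
Let T (k : nat) := \sum_(j < n | (j < k)%N) a j *: e j.
Let w (i : 'I_n) := - (t * a i / (1 + t * B i)) *: T i + e i.

Lemma gram0l v : G 0 v = 0.
Proof.
by have := Glin 1 0 0 v; rewrite scaler0 addr0 => G0; lra.
Qed.

Lemma gram_suml (I : Type) (r : seq I) (P : pred I) (b : I -> R) v u :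
  G (\sum_(i <- r | P i) b i *: v i) u = \sum_(i <- r | P i) b i * G (v i) u.
Proof.
by elim/big_rec2: _ => [|i y x _ <-]; [exact: gram0l|rewrite Glin].
Qed.

Lemma gram_den_gt0 k : 0 < 1 + t * B k.
Proof.
by rewrite ltr_pwDl// mulr_ge0// sumr_ge0// => j _; exact: sqr_ge0.
Qed.

(** Thus [T k] represents [d] with respect to [G] on the span of the e_j with j < k, and is
    orthogonal to the remaining e_j. *)
Lemma gram_T_e k i : G (T k) (e i) = if (i < k)%N then a i else 0.
Proof.
rewrite gram_suml; case: ifPn => ik.
  rewrite (bigD1 i)//= Ge eqxx mulr1 big1 ?addr0// => j /andP[_ ji].
  by rewrite Ge (negbTE ji) mulr0.
rewrite big1// => j jk; rewrite Ge; case: eqP => [ji|]; last by rewrite mulr0.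
by rewrite -ji jk in ik.
Qed.

Lemma gram_T_T i k : (i <= k)%N -> G (T i) (T k) = B i.
Proof.
move=> ik; rewrite gram_suml; apply: eq_bigr => j ji.
by rewrite Gsym gram_T_e (leq_trans ji ik) expr2.
Qed.

Lemma d_T k : d (T k) = B k.
Proof. by rewrite linear_sum; apply: eq_bigr => j _; rewrite linearZ expr2. Qed.

Lemma d_w i : d (w i) = a i / (1 + t * B i).
Proof.
rewrite linearD linearZ /= d_T -/(a i) [_ *: _]mulrC.
by field; rewrite gt_eqF// gram_den_gt0.
Qed.

(** The vector [w i] lies in the span of the e_j with j < k, where [T k] represents [d] and to which
    e_k is orthogonal. Hence G (w i, w k) is -t a_k / (1 + t B_k) times d (w i), which is -t d (w i)
    d (w k) by [d_w]. *)
Lemma gram_w_lt (i k : 'I_n) : (i < k)%N ->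
  G (w i) (w k) + t * (d (w i) * d (w k)) = 0.
Proof.
(* [Glin] is linearity in the first argument, so each argument is moved there by symmetry before it
   is expanded. *)
move=> ik; rewrite !d_w [G _ _]Gsym Glin ![G _ (w i)]Gsym !Glin.
rewrite !gram_T_e (leq_gtF (ltnW ik)) gram_T_T 1?ltnW// [G (e i) (T k)]Gsym.
rewrite gram_T_e ik Ge -val_eqE (ltn_eqF ik) mulr0n.
by field; rewrite !gt_eqF ?gram_den_gt0.
Qed.

Lemma gram_B_S (i : 'I_n) : B i.+1 = B i + a i ^+ 2.
Proof.
rewrite /B (bigD1 i)//= addrC; congr (_ + _); apply: eq_bigl => j.
by rewrite ltnS ltn_neqAle andbC.
Qed.

(** Off the diagonal the left side is symmetric, which leaves i < k. On the diagonal T_i is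
    orthogonal to e_i, and the value is 1 + t a_i^2 (t B_i + 1) / (1 + t B_i)^2 = 1 + t a_i^2 / (1 +
    t B_i). *)
Lemma gram_w (i k : 'I_n) : G (w i) (w k) + t * (d (w i) * d (w k)) =
  (i == k)%:R * ((1 + t * B i.+1) / (1 + t * B i)).
Proof.
have [->|/eqP ik] := eqVneq i k; last first.
  rewrite mul0r; have [/gram_w_lt//|ki|/val_inj/ik//] := ltngtP i k.
  by rewrite Gsym [d _ * _]mulrC; exact: gram_w_lt.
rewrite mul1r gram_B_S !d_w Glin [G (e k) _]Gsym ![G _ (w k)]Gsym !Glin.
rewrite [G (e k) (T k)]Gsym !gram_T_e ltnn gram_T_T// Ge eqxx mulr1n.
by field; rewrite gt_eqF ?gram_den_gt0.
Qed.

End rank_one_gram.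

(** * The frame of the product *)

(** Pairing a vanishing combination of the rows with [u j] isolates its j-th coefficient, so the
    rows are linearly independent. *)
Lemma orthonormal_unitmx (R : realType) (m : nat)
    (G : 'rV[R]_m -> 'rV[R]_m -> R)
    (Glin : forall a v v' w, G (a *: v + v') w = a * G v w + G v' w)
    (u : 'I_m -> 'rV[R]_m) (Gu : forall i j, G (u i) (u j) = (i == j)%:R) :
  (\matrix_i u i) \in unitmx.
Proof.
rewrite -row_free_unit; apply: inj_row_free => v; rewrite mulmx_sum_row => v0.
apply/rowP => j; rewrite mxE.
transitivity (G (\sum_i v 0 i *: row i (\matrix_i u i)) (u j)).
  rewrite gram_suml// (bigD1 j)//= rowK Gu eqxx mulr1 big1 ?addr0// => i ij.
  by rewrite rowK Gu (negbTE ij) mulr0.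
by rewrite v0; exact: gram0l.
Qed.

Lemma dfun_linear (R : realType) (m : nat) (M : manifold R m) (f : M -> R)
    (p : M) (a : R) (v w : 'rV[R]_m) :
  dfun f (p := p) (a *: v + w) = a * dfun f (p := p) v + dfun f (p := p) w.
Proof. by rewrite /dfun linearD linearZ. Qed.

Section product_frame.
Context {R : realType} {m1 m2 : nat} {M1 : manifold R m1} {M2 : manifold R m2}.
Context {g1 : tensor2 M1} {g2 : tensor2 M2}.
Hypotheses (hg1 : riemannian_metric g1) (hg2 : riemannian_metric g2).
Context (c : R) {f1 : M1 -> R} {f2 : M2 -> R}.
Hypotheses (f1_smooth : smooth_fun setT f1) (f2_smooth : smooth_fun setT f2).
Hypothesis f1_gt0 : forall p, 0 < f1 p.
Context {U1 : set M1} {U2 : set M2}.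
Context {e1 : 'I_m1 -> vfield M1} {e2 : 'I_m2 -> vfield M2}.
Hypotheses (he1 : local_orthonormal_frame g1 U1 e1)
           (he2 : local_orthonormal_frame g2 U2 e2).
Let M := prod_manifold M1 M2.
Let h : tensor2 M := metric_h c g1 g2 f1 f2.
Let u' := frame_u' c f1 f2 e1 e2.
Let oU1 : open U1 := frame_open (onframe_frame he1).
Let oU2 : open U2 := frame_open (onframe_frame he2).
Let oU : open (U1 `*` U2 : set M) := open_setX oU1 oU2.

(** Quotients of consecutive values are the squared norms of the horizontal u'_i. *)
Definition frame_den (k : nat) (p : M) : R :=
  1 + (c * vlift_fun f2 p) ^+ 2 * hlift_fun (frame_B e1 f1 k) p.

Lemma frame_den_gt0 k p : 0 < frame_den k p.
Proof.
rewrite ltr_pwDl// mulr_ge0 ?sqr_ge0// sumr_ge0// => j _; exact: sqr_ge0.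
Qed.

(** Expressing the metric through the two blocks of a row vector turns every Gram computation into
    pointwise linear algebra on the factors. *)
Lemma metric_hE (p : M) (v w : tangent p) : h v w =
  g1 (lsubmx v : tangent p.1) (lsubmx w) +
  f1 p.1 ^+ 2 * g2 (rsubmx v : tangent p.2) (rsubmx w) +
  (c * f2 p.2) ^+ 2 *
    (dfun f1 (lsubmx v : tangent p.1) * dfun f1 (lsubmx w : tangent p.1)).
Proof.
rewrite /h /metric_h /pullback /odot !dmap_proj1 !dmap_proj2.
rewrite !(dfun_hlift_fun _ f1_smooth) /hlift_fun /vlift_fun /=.
by congr (_ + _); field.
Qed.

(** A [tensor2] carries no linearity of its own; it is inherited here from the two metrics and from
    the differential of [f1]. *)
Lemma metric_h_linear (p : M) (a : R) (v v' w : 'rV[R]_(m1 + m2)) :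
  h (p := p) (a *: v + v') w = a * h (p := p) v w + h (p := p) v' w.
Proof.
rewrite !metric_hE.
rewrite ![lsubmx (_ + _)]linearD ![rsubmx (_ + _)]linearD /=.
rewrite ![lsubmx (_ *: _)]linearZ ![rsubmx (_ *: _)]linearZ /=.
rewrite (metric_linear hg1) (metric_linear hg2).
by rewrite dfun_linear; ring.
Qed.

Lemma frame_u'l (i : 'I_m1) (p : M) : u' (lshift m2 i) p =
  row_mx (- ((c * f2 p.2) ^+ 2 * frame_a e1 f1 i p.1 / frame_den i p) *:
            (frame_T e1 f1 i p.1 : 'rV[R]_m1) + e1 i p.1) 0 :> 'rV[R]_(m1 + m2).
Proof.
rewrite /u' /frame_u' (unsplitK (inl i)) !hliftE scale_row_mx add_row_mx.
by rewrite scaler0 addr0.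
Qed.

Lemma frame_u'r (j : 'I_m2) (p : M) : u' (rshift m1 j) p =
  row_mx 0 ((f1 p.1)^-1 *: (e2 j p.2 : 'rV[R]_m2)) :> 'rV[R]_(m1 + m2).
Proof.
by rewrite /u' /frame_u' (unsplitK (inr j)) vliftE scale_row_mx scaler0.
Qed.

(** * Gram matrices of the u'_i and of the u_i *)

Lemma frame_u'_gram_ll (i k : 'I_m1) (p : M) : (U1 `*` U2) p ->
  h (u' (lshift m2 i) p) (u' (lshift m2 k) p) =
  (i == k)%:R * (frame_den i.+1 p / frame_den i p).
Proof.
move=> [/= Up _]; rewrite metric_hE !frame_u'l !row_mxKl !row_mxKr.
have g0 : g2 (0 : tangent p.2) 0 = 0.
  exact: (gram0l (@metric_linear _ _ _ _ hg2 p.2)).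
rewrite g0 mulr0 addr0.
(* At a fixed point (c f_2)^2 is a nonnegative constant t. The differential of [f1] is passed as a
   bundled linear map, of which [dfun] is the underlying function. *)
exact: (gram_w (Defs.metric_sym hg1 (p := p.1)) (@metric_linear _ _ _ _ hg1 p.1)
  ('d (f1 \o chart_inv (chart_at p.1)) (chart_at p.1 p.1))
  (onframe_orthonormal he1 Up) (sqr_ge0 (c * f2 p.2)) i k).
Qed.

(** The two vectors have complementary zero blocks, which kills the g1 and g2 terms, and the
    differential of the lifted [f1] vanishes on vertical vectors. *)
Lemma frame_u'_gram_lr (i : 'I_m1) (j : 'I_m2) (p : M) :
  h (u' (lshift m2 i) p) (u' (rshift m1 j) p) = 0.
Proof.
rewrite metric_hE frame_u'l frame_u'r !row_mxKl !row_mxKr.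
rewrite (Defs.metric_sym hg1) (gram0l (@metric_linear _ _ _ _ hg1 p.1)).
rewrite (gram0l (@metric_linear _ _ _ _ hg2 p.2)).
by rewrite [dfun f1 0]linear0 !mulr0 !addr0.
Qed.

(** On vertical vectors only f_1^2 g_2 survives, and the two factors 1/f_1 cancel f_1^2. *)
Lemma frame_u'_gram_rr (i j : 'I_m2) (p : M) : (U1 `*` U2) p ->
  h (u' (rshift m1 i) p) (u' (rshift m1 j) p) = (i == j)%:R.
Proof.
move=> [/= _ Up]; rewrite metric_hE !frame_u'r !row_mxKl !row_mxKr.
rewrite (gram0l (@metric_linear _ _ _ _ hg1 p.1)).
have gZ a v w : g2 (a *: v : tangent p.2) w = a * g2 (v : tangent p.2) w.
  have := metric_linear hg2 (p := p.2) a v 0 w.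
  by rewrite addr0 (gram0l (@metric_linear _ _ _ _ hg2 p.2)) addr0.
rewrite gZ (Defs.metric_sym hg2) gZ (onframe_orthonormal he2 Up) eq_sym.
rewrite [dfun f1 0]linear0 !mulr0 addr0 add0r.
by field; rewrite gt_eqF.
Qed.

Lemma metric_h_sym (p : M) (v w : tangent p) : h v w = h w v.
Proof.
rewrite !metric_hE (Defs.metric_sym hg1) (Defs.metric_sym hg2).
by rewrite [dfun _ _ * _]mulrC.
Qed.

Lemma metric_hZ (p : M) (a b : R) (v w : 'rV[R]_(m1 + m2)) :
  h (p := p) (a *: v) (b *: w) = a * b * h (p := p) v w.
Proof.
have hZ x v1 w1 : h (p := p) (x *: v1) w1 = x * h (p := p) v1 w1.
  have := metric_h_linear p x v1 0 w1.
  by rewrite addr0 (gram0l (metric_h_linear p)) addr0.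
by rewrite hZ metric_h_sym hZ metric_h_sym mulrA.
Qed.

Lemma tnorm_frame_u' (i : 'I_m1) (p : M) : (U1 `*` U2) p ->
  tnorm h (u' (lshift m2 i) p) = Num.sqrt (frame_den i.+1 p / frame_den i p).
Proof. by move=> Up; rewrite /tnorm frame_u'_gram_ll// eqxx mul1r. Qed.

Let u := frame_u c g1 g2 f1 f2 e1 e2.

(** The explicit normalising factor serves both orthonormality and smoothness: it is an inverse
    square root of a positive smooth function. It is known on [U1]*[U2] only, where e_1 is
    orthonormal. *)
Lemma frame_ul (i : 'I_m1) (p : M) : (U1 `*` U2) p -> u (lshift m2 i) p =
  (Num.sqrt (frame_den i.+1 p / frame_den i p))^-1 *:
    (u' (lshift m2 i) p : 'rV[R]_(m1 + m2)).
Proof. by move=> Up; rewrite -tnorm_frame_u'// /u /frame_u (unsplitK (inl i)). Qed.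

Lemma frame_ur (j : 'I_m2) (p : M) : u (rshift m1 j) p = u' (rshift m1 j) p.
Proof. by rewrite /u /frame_u (unsplitK (inr j)). Qed.

Lemma frame_u_gram (p : M) (i j : 'I_(m1 + m2)) : (U1 `*` U2) p ->
  h (u i p) (u j p) = (i == j)%:R.
Proof.
move=> Up; have [i' ->|i' ->] := split_ordP i; have [j' ->|j' ->] := split_ordP j;
  rewrite ?frame_ul// ?frame_ur.
- rewrite metric_hZ frame_u'_gram_ll// (inj_eq (@lshift_inj _ _)).
  have [<-|_] := eqVneq i' j'; last by rewrite mul0r mulr0.
  rewrite mul1r -invfM -expr2 sqr_sqrtr ?mulVf//.
    by rewrite gt_eqF// divr_gt0// frame_den_gt0.
  by rewrite ltW// divr_gt0// frame_den_gt0.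
- rewrite -[u' (rshift _ _) _]scale1r metric_hZ frame_u'_gram_lr mulr0.
  by rewrite eq_lrshift.
- rewrite metric_h_sym -[u' (rshift _ _) _]scale1r metric_hZ frame_u'_gram_lr.
  by rewrite mulr0 eq_rlshift.
- by rewrite frame_u'_gram_rr// (inj_eq (@rshift_inj _ _)).
Qed.

(** * Smoothness of the fields u_i *)

Let f1_smoothU : smooth_fun U1 f1.
Proof. exact: smooth_fun_subset f1_smooth. Qed.

Let e1_smooth i : smooth_vfield U1 (e1 i) := frame_smooth (onframe_frame he1) i.
Let e2_smooth i : smooth_vfield U2 (e2 i) := frame_smooth (onframe_frame he2) i.

Lemma smooth_frame_a i : smooth_fun U1 (frame_a e1 f1 i).
Proof. exact: smooth_dfun. Qed.

Lemma smooth_frame_T k : smooth_vfield U1 (frame_T e1 f1 k).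
Proof.
apply: (smooth_vfield_sum _
  (F := fun j p => frame_a e1 f1 j p *: (e1 j p : 'rV[R]_m1))) => // j _.
by apply: smooth_vfieldZ => //; exact: smooth_frame_a.
Qed.

Lemma smooth_frame_cf2 :
  smooth_fun (U1 `*` U2 : set M) (fun p => (c * vlift_fun f2 p) ^+ 2).
Proof.
have s : smooth_fun (U1 `*` U2 : set M) (fun p => c * vlift_fun f2 p).
  apply: smooth_funM => //; first exact: smooth_fun_cst.
  by apply: smooth_vlift_fun => //; exact: smooth_fun_subset f2_smooth.
by apply: smooth_fun_eq (smooth_funM oU s s) => // p _; rewrite expr2.
Qed.

Lemma smooth_frame_den k : smooth_fun (U1 `*` U2 : set M) (frame_den k).
Proof.
apply: smooth_funD => //; first exact: smooth_fun_cst.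
apply: smooth_funM => //; first exact: smooth_frame_cf2.
apply: smooth_hlift_fun => //.
apply: (smooth_fun_sum _ (F := fun j p => frame_a e1 f1 j p ^+ 2)) => // j _.
have s := smooth_frame_a j.
by apply: smooth_fun_eq (smooth_funM oU1 s s) => // p _; rewrite expr2.
Qed.

Lemma smooth_frame_den_div (f : M -> R) k : smooth_fun (U1 `*` U2 : set M) f ->
  smooth_fun (U1 `*` U2 : set M) (fun p => f p / frame_den k p).
Proof.
move=> sf; apply: smooth_funM => //; apply: smooth_funV => // [p _|].
  exact: frame_den_gt0.
exact: smooth_frame_den.
Qed.

Lemma smooth_frame_u'l i : smooth_vfield (U1 `*` U2 : set M) (u' (lshift m2 i)).
Proof.
pose a p := (c * vlift_fun f2 p) ^+ 2 * hlift_fun (frame_a e1 f1 i) p.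
(* The sign of the coefficient is carried by the constant function -1, so that closure under
   products suffices. *)
have sa : smooth_fun (U1 `*` U2 : set M) (fun p => -1 * (a p / frame_den i p)).
  apply: smooth_funM => //; first exact: smooth_fun_cst.
  apply: smooth_frame_den_div; apply: smooth_funM => //; first exact: smooth_frame_cf2.
  by apply: smooth_hlift_fun => //; exact: smooth_frame_a.
have sT := smooth_hlift oU1 oU2 (smooth_frame_T i).
have se := smooth_hlift oU1 oU2 (e1_smooth i).
apply: smooth_vfield_eq (smooth_vfieldD oU (smooth_vfieldZ oU sa sT) se) => // p _.
by rewrite mulN1r /u' /frame_u' (unsplitK (inl i)).
Qed.

Lemma smooth_frame_u'r j : smooth_vfield (U1 `*` U2 : set M) (u' (rshift m1 j)).
Proof.
have sV : smooth_fun (U1 `*` U2 : set M) (fun p => (hlift_fun f1 p)^-1).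
  apply: smooth_funV => // [p _|]; first exact: f1_gt0.
  exact: smooth_hlift_fun.
have se := smooth_vlift oU1 oU2 (e2_smooth j).
apply: smooth_vfield_eq (smooth_vfieldZ oU sV se) => // p _.
by rewrite /u' /frame_u' (unsplitK (inr j)).
Qed.

Lemma smooth_frame_u i : smooth_vfield (U1 `*` U2 : set M) (u i).
Proof.
have [i' ->|j ->] := split_ordP i; last first.
  apply: smooth_vfield_eq (smooth_frame_u'r j) => // p _.
  by rewrite frame_ur.
have sN := smooth_frame_den_div i' (smooth_frame_den i'.+1).
have sV : smooth_fun (U1 `*` U2 : set M)
    (fun p => (Num.sqrt (frame_den i'.+1 p / frame_den i' p))^-1).
  by apply: smooth_fun_invsqrt => // p _; rewrite divr_gt0// frame_den_gt0.
apply: smooth_vfield_eq (smooth_vfieldZ oU sV (smooth_frame_u'l i')) => // p Up.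
by rewrite frame_ul.
Qed.

Lemma local_orthonormal_frame_u : local_orthonormal_frame h (U1 `*` U2) u.
Proof.
split; last by move=> p Up i j; exact: frame_u_gram.
split; [exact: oU|exact: smooth_frame_u|move=> p Up].
(* Being a basis at [p] is deduced from orthonormality. *)
apply: (orthonormal_unitmx (metric_h_linear p)) => i j; exact: frame_u_gram.
Qed.

End product_frame.

Theorem lemma4p3 (R : realType) (m1 m2 : nat)
    (M1 : manifold R m1) (M2 : manifold R m2)
    (g1 : tensor2 M1) (g2 : tensor2 M2)
    (hg1 : riemannian_metric g1) (hg2 : riemannian_metric g2)
    (c : R) (f1 : M1 -> R) (f2 : M2 -> R)
    (f1_smooth : smooth_fun setT f1) (f2_smooth : smooth_fun setT f2)
    (f1_pos : forall p, 0 < f1 p) (f2_pos : forall p, 0 < f2 p)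
    (U1 : set M1) (U2 : set M2)
    (e1 : 'I_m1 -> vfield M1) (e2 : 'I_m2 -> vfield M2)
    (he1 : local_orthonormal_frame g1 U1 e1)
    (he2 : local_orthonormal_frame g2 U2 e2) :
  (forall (i : 'I_m1) (p : prod_manifold M1 M2), (U1 `*` U2) p ->
     tnorm (metric_h c g1 g2 f1 f2)
       (frame_u' c f1 f2 e1 e2 (lshift m2 i) p) ^+ 2 =
     (1 + (c * vlift_fun f2 p) ^+ 2 * hlift_fun (frame_B e1 f1 i.+1) p) /
     (1 + (c * vlift_fun f2 p) ^+ 2 * hlift_fun (frame_B e1 f1 i) p)) /\
  @local_orthonormal_frame _ _ (prod_manifold M1 M2)
    (metric_h c g1 g2 f1 f2) (U1 `*` U2) (frame_u c g1 g2 f1 f2 e1 e2).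
Proof.
split; last exact: local_orthonormal_frame_u.
move=> i p Up; rewrite (tnorm_frame_u' hg1 hg2 c f1_smooth he1 i Up).
(* The numerator and denominator of the statement are [frame_den] at [i.+1] and [i] by conversion;
   their positivity lets the square cancel the root. *)
by rewrite sqr_sqrtr// ltW// divr_gt0// frame_den_gt0.
Qed.
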